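(* Let $H$ be a commutative Hopf heap with a Rota-Baxter operator $B$, let $(M,T)$ be a Rota-Baxter Hopf heap module over $(H,B)$, and let $x\in G(H)$. Put $M^{coH}_x=\{m\in M:\ \rho(m)=m\otimes x\}$ and define, for $m\in M$, $h\in H$, $$\widehat{T}(m\otimes h)=T(m\lhd(x\otimes h_1))_{(0)}\lhd\big(T(m\lhd(x\otimes h_1))_{(1)}\otimes x\big)\otimes B(h_2).$$ Then: (a) $\mathrm{Im}\,\widehat{T}\subset M^{coH}_x\otimes H$. (b) If $\varepsilon\circ B=\varepsilon$, then there exists an isomorphism of Rota-Baxter Hopf heap modules over $(H,B)$ $$(M,T)\cong(M^{coH}_x\otimes H,\widehat{T}),$$ where $\widehat T$ is restricted to $M^{coH}_x\otimes H$, and $M^{coH}_x\otimes H$ is the right $H$-Hopf heap module with action $(m\otimes h)\lhd(g\otimes l)=m\otimes[h,g,l]$ and coaction $m\otimes h\mapsto m\otimes h_1\otimes h_2$.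
   Context: Everything is over a fixed field $\mathbf{k}$. Sweedler notation $\Delta(c)=c_1\otimes c_2$ (iterated: $c_1\otimes c_2\otimes c_3\otimes\cdots$) is used; $C^{cop}$ is the co-opposite coalgebra; $G(C)$ is the set of group-like elements of a coalgebra $C$ (assumed non-empty). A Hopf heap is a coalgebra $C$ with a coalgebra map $C\otimes C^{cop}\otimes C\to C$, $a\otimes b\otimes c\mapsto[a,b,c]$, such that $[[a,b,c],d,h]=[a,b,[c,d,h]]$ and $[c_1,c_2,a]=[a,c_1,c_2]=\varepsilon(c)a$ for all $a,b,c,d,h\in C$. It is commutative if $[x,y,z]=[z,y,x]$ for all $x,y,z$. A Rota-Baxter operator on a Hopf heap $C$ is a linear map $B:C\to C$ with $B([a,b,c])=[B(a),B(b),B(c)]$ and $B(a_1)\otimes B(a_2)=[B(a)_1,B(B(a)_4),B(B(a)_2)]\otimes B(a)_3$ for all $a,b,c\in C$; then $(C,B)$ is called a Rota-Baxter Hopf heap. A right $H$-Hopf heap module is a right $H$-comodule $(M,\rho)$, $\rho(m)=m_{(0)}\otimes m_{(1)}$, with a linear map $\lhd:M\otimes H^{cop}\otimes H\to M$, written $m\lhd(c\otimes d)$, such that for all $a,b,c,d\in H$, $m\in M$: $m\lhd(a\otimes[b,c,d])=(m\lhd(a\otimes b))\lhd(c\otimes d)$; $m\lhd(c_1\otimes c_2)=\varepsilon(c)m$; $\rho(m\lhd(c\otimes d))=m_{(0)}\lhd(c_2\otimes d_1)\otimes[m_{(1)},c_1,d_2]$. A morphism of right $H$-Hopf heap modules is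 a right $H$-comodule map $f$ with $f(m\lhd(a\otimes b))=f(m)\lhd(a\otimes b)$. A Rota-Baxter Hopf heap module over a Rota-Baxter Hopf heap $(H,B)$ is a pair $(M,T)$ of a right $H$-Hopf heap module $M$ and a linear map $T:M\to M$ such that for all $m\in M$ $$T(m_{(0)})\otimes B(m_{(1)})=T(m)_{(0)}\lhd\big(B(T(m)_{(1)3})\otimes B(T(m)_{(1)1})\big)\otimes T(m)_{(1)2},$$ where $T(m)_{(1)1}\otimes T(m)_{(1)2}\otimes T(m)_{(1)3}$ is the iterated coproduct of $T(m)_{(1)}$. A morphism $(M,T_M)\to(N,T_N)$ is a morphism $f:M\to N$ of right $H$-Hopf heap modules with $f\circ T_M=T_N\circ f$. *)

(* Defs.v *)
From HB Require Import structures.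
From mathcomp Require Import all_boot all_algebra sesquilinear.
From mathcomp Require Import generic_quotient boolp.

Set Implicit Arguments.
Unset Strict Implicit.
Unset Printing Implicit Defensive.

Import GRing.Theory.
Local Open Scope quotient_scope.
Local Open Scope ring_scope.

Reserved Notation "u ⊗ v" (at level 40, left associativity).
Reserved Notation "m ◁ t" (at level 40, left associativity).
Reserved Notation "C ^cop" (at level 1, format "C ^cop").
Reserved Notation "⟦ a , b , c ⟧".
Reserved Notation "\sw_ ( a ⊗ b <- z ) E"
  (at level 41, a name, b name, z, E at level 41,
   format "'[' \sw_ ( a  ⊗  b  <-  z ) '/  '  E ']'").
Reserved Notation "\sw_ ( a ⊗ b ⊗ c <- z ) E"
  (at level 41, a name, b name, c name, z, E at level 41,
   format "'[' \sw_ ( a  ⊗  b  ⊗  c  <-  z ) '/  '  E ']'").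
Reserved Notation "\sw_ ( a ⊗ b ⊗ c ⊗ d <- z ) E"
  (at level 41, a name, b name, c name, d name, z, E at level 41,
   format "'[' \sw_ ( a  ⊗  b  ⊗  c  ⊗  d  <-  z ) '/  '  E ']'").

Notation is_bilinear := (bilinear_for *:%R *:%R).

(* Elements of U ⊗ V are formal sums of pairs (u, v), two formal sums being
   identified iff no bilinear map tells them apart; [tensor_universal] below is
   the universal property. *)
Section Tensor.
Variables (k : fieldType) (U V : lmodType k).
Implicit Types (s t : seq (U * V)).

Definition formal_eval (W : lmodType k) (f : U -> V -> W) s : W :=
  \sum_(p <- s) f p.1 p.2.

Definition tensor_rel s t : bool :=
  `[< forall (W : lmodType k) (f : U -> V -> W),
        is_bilinear f -> formal_eval f s = formal_eval f t >].

Fact tensor_rel_equiv : equiv_class_of tensor_rel.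
Proof.
split=> [s|s t|t s r].
- by apply/asboolP.
- by apply/asboolP/asboolP => st W f fB; rewrite st.
- move=> /asboolP st /asboolP tr; apply/asboolP => W f fB.
  by rewrite st // tr.
Qed.

Canonical tensor_equiv := EquivRelPack tensor_rel_equiv.

Definition tensor : Type := {eq_quot tensor_rel}.
HB.instance Definition _ := Choice.on tensor.
HB.instance Definition _ := EqQuotient.on tensor.

Definition tens_of s : tensor := \pi_tensor s.

Lemma tens_ofP s t :
  tens_of s = tens_of t <->
  forall (W : lmodType k) (f : U -> V -> W),
    is_bilinear f -> formal_eval f s = formal_eval f t.
Proof.
split=> [/eqmodP/asboolP // | st].
exact/eqmodP/asboolP.
Qed.

Lemma tens_of_repr (z : tensor) : tens_of (repr z) = z.
Proof. exact: reprK. Qed.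

Lemma repr_eval s (W : lmodType k) (f : U -> V -> W) : is_bilinear f ->
  formal_eval f (repr (tens_of s)) = formal_eval f s.
Proof. by move=> fB; move: W f fB; apply/tens_ofP; rewrite tens_of_repr. Qed.

Definition formal_scale (a : k) s := [seq (a *: p.1, p.2) | p <- s].

Lemma formal_eval_scale (W : lmodType k) (f : U -> V -> W) a s :
  is_bilinear f -> formal_eval f (formal_scale a s) = a *: formal_eval f s.
Proof.
move=> fB; rewrite /formal_eval big_map scaler_sumr.
by apply: eq_bigr => p _ /=; have /= := scalable_linear (fB.1 p.2) a p.1.
Qed.

Lemma formal_eval_cat (W : lmodType k) (f : U -> V -> W) s t :
  formal_eval f (s ++ t) = formal_eval f s + formal_eval f t.
Proof. exact: big_cat. Qed.

Let t0 : tensor := tens_of [::].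
Let tadd (x y : tensor) : tensor := tens_of (repr x ++ repr y).
Let tscale (a : k) (x : tensor) : tensor := tens_of (formal_scale a (repr x)).
Let topp (x : tensor) : tensor := tscale (-1) x.

Fact taddA : associative tadd.
Proof.
move=> x y z; apply/tens_ofP => W f fB.
by rewrite !(formal_eval_cat, repr_eval) // addrA.
Qed.
Fact taddC : commutative tadd.
Proof.
move=> x y; apply/tens_ofP => W f fB.
by rewrite !(formal_eval_cat, repr_eval) // addrC.
Qed.
Fact tadd0 : left_id t0 tadd.
Proof.
move=> x; rewrite -[RHS]tens_of_repr; apply/tens_ofP => W f fB.
by rewrite !(formal_eval_cat, repr_eval) // /formal_eval big_nil add0r.
Qed.
Fact taddN : left_inverse t0 topp tadd.
Proof.
move=> x; apply/tens_ofP => W f fB.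
rewrite !(formal_eval_cat, repr_eval, formal_eval_scale) //.
by rewrite scaleN1r addNr /formal_eval big_nil.
Qed.
HB.instance Definition _ := GRing.isZmodule.Build tensor taddA taddC tadd0 taddN.

Fact tscaleA a b x : tscale a (tscale b x) = tscale (a * b) x.
Proof.
apply/tens_ofP => W f fB.
by rewrite !(formal_eval_cat, repr_eval, formal_eval_scale) // scalerA.
Qed.
Fact tscale1 : left_id 1 tscale.
Proof.
move=> x; rewrite -[RHS]tens_of_repr; apply/tens_ofP => W f fB.
by rewrite !(formal_eval_cat, repr_eval, formal_eval_scale) // scale1r.
Qed.
Fact tscaleDr : right_distributive tscale +%R.
Proof.
move=> a x y; apply/tens_ofP => W f fB.
by rewrite !(formal_eval_cat, repr_eval, formal_eval_scale) // scalerDr.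
Qed.
Fact tscaleDl x : {morph tscale^~ x : a b / a + b}.
Proof.
move=> a b; apply/tens_ofP => W f fB.
by rewrite !(formal_eval_cat, repr_eval, formal_eval_scale) // scalerDl.
Qed.
HB.instance Definition _ :=
  GRing.Zmodule_isLmodule.Build k tensor tscaleA tscale1 tscaleDr tscaleDl.

Definition tens (u : U) (v : V) : tensor := tens_of [:: (u, v)].

Lemma tens_ofD s t : tens_of (s ++ t) = tens_of s + tens_of t.
Proof.
by apply/tens_ofP => W f fB; rewrite !formal_eval_cat !repr_eval.
Qed.

Lemma tens_ofZ a s : tens_of (formal_scale a s) = a *: tens_of s.
Proof.
by apply/tens_ofP => W f fB; rewrite !(formal_eval_scale, repr_eval).
Qed.

(* Sweedler notation: [sweedler z F] is \sum_i F u_i v_i for a chosen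
   presentation z = \sum_i u_i ⊗ v_i.  The value does not depend on the
   presentation as soon as F is bilinear, see [sweedler_tens] and
   [sweedler_linear]. *)
Definition sweedler (W : lmodType k) (z : tensor) (F : U -> V -> W) : W :=
  formal_eval F (repr z).

Lemma sweedler_tens (W : lmodType k) (F : U -> V -> W) u v :
  is_bilinear F -> sweedler (tens u v) F = F u v.
Proof.
by move=> FB; rewrite /sweedler repr_eval // /formal_eval big_seq1.
Qed.

Lemma sweedler_linear (W : lmodType k) (F : U -> V -> W) :
  is_bilinear F -> linear (fun z => sweedler z F).
Proof.
move=> FB a x y; rewrite /sweedler.
by rewrite !(formal_eval_cat, repr_eval, formal_eval_scale).
Qed.

Lemma tens_bilinear : is_bilinear tens.
Proof.
split=> [v | u] a x y /=; rewrite -tens_ofZ -tens_ofD; apply/tens_ofP => W f fB;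
  rewrite formal_eval_cat formal_eval_scale // /formal_eval !big_seq1.
  exact: (fB.1 v).
exact: (fB.2 u).
Qed.

Lemma sweedler_id (z : tensor) : sweedler z tens = z.
Proof.
rewrite -[RHS]tens_of_repr /sweedler /formal_eval.
elim: (repr z) => [|p s IHs]; first by rewrite big_nil.
by rewrite big_cons {}IHs -tens_ofD; case: p.
Qed.

Lemma eq_sweedler (W : lmodType k) z (F G : U -> V -> W) :
  (forall u v, F u v = G u v) -> sweedler z F = sweedler z G.
Proof. by move=> FG; apply: eq_bigr => p _. Qed.

Lemma sweedler_apply (W W' : lmodType k) (f : W -> W') z (F : U -> V -> W) :
  linear f -> f (sweedler z F) = sweedler z (fun u v => f (F u v)).
Proof.
move=> fL; pose Lf := GRing.isLinear.Build _ _ _ _ f fL.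
pose f' : {linear W -> W'} := HB.pack f Lf.
by rewrite -[f]/(f' : _ -> _) /sweedler /formal_eval linear_sum.
Qed.

Lemma sweedler_linear_param (W W' : lmodType k) z (F : W' -> U -> V -> W) :
  (forall u v, linear (fun x => F x u v)) -> linear (fun x => sweedler z (F x)).
Proof.
move=> FL a x y; rewrite /sweedler /formal_eval scaler_sumr -big_split.
by apply: eq_bigr => p _; exact: FL.
Qed.

Lemma tensor_linear_ext (W : lmodType k) (f g : tensor -> W) :
  linear f -> linear g -> (forall u v, f (tens u v) = g (tens u v)) -> f =1 g.
Proof.
move=> fL gL fg z; rewrite -(sweedler_id z) !sweedler_apply //.
exact: eq_sweedler.
Qed.

Lemma tensor_universal (W : lmodType k) (F : U -> V -> W) : is_bilinear F ->
  exists2 f : {linear tensor -> W},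
    (forall u v, f (tens u v) = F u v) &
    (forall g : {linear tensor -> W}, (forall u v, g (tens u v) = F u v) ->
       g =1 f).
Proof.
move=> FB; pose Lf := GRing.isLinear.Build _ _ _ _ _ (sweedler_linear FB).
pose f : {linear tensor -> W} := HB.pack (fun z => sweedler z F) Lf.
exists f => [u v|g gF]; first exact: sweedler_tens.
apply: tensor_linear_ext => [||u v]; try exact: linearP.
by rewrite gF [RHS]sweedler_tens.
Qed.

End Tensor.

Notation "U ⊗ V" := (tensor U%type V%type) : type_scope.
Notation "u ⊗ v" := (tens u v) : ring_scope.
Notation "\sw_ ( a ⊗ b <- z ) E" := (sweedler z (fun a b => E)) : ring_scope.
Notation "\sw_ ( a ⊗ b ⊗ c <- z ) E" :=
  (sweedler z (fun ab c => sweedler ab (fun a b => E))) : ring_scope.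
Notation "\sw_ ( a ⊗ b ⊗ c ⊗ d <- z ) E" :=
  (sweedler z (fun abc d => sweedler abc (fun ab c =>
     sweedler ab (fun a b => E)))) : ring_scope.

Definition tensor_map (k : fieldType) (U V U' V' : lmodType k)
    (f : U -> U') (g : V -> V') (z : U ⊗ V) : U' ⊗ V' :=
  \sw_(u ⊗ v <- z) f u ⊗ g v.

Section LinearityLemmas.
Variables (k : fieldType) (X U V W : lmodType k).

Lemma lin_id : linear (fun x : X => x). Proof. by []. Qed.

Lemma lin_comp (f : {linear U -> V}) (g : X -> U) :
  linear g -> linear (fun x => f (g x)).
Proof. by move=> gL a x y; rewrite gL linearP. Qed.

Lemma lin_tensl (g : X -> U) (v : V) : linear g -> linear (fun x => g x ⊗ v).
Proof. by move=> gL a x y; rewrite gL; apply: (tens_bilinear U V).1. Qed.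

Lemma lin_tensr (u : U) (g : X -> V) : linear g -> linear (fun x => u ⊗ g x).
Proof. by move=> gL a x y; rewrite gL; apply: (tens_bilinear U V).2. Qed.

Lemma lin_sweedler (g : X -> U ⊗ V) (F : U -> V -> W) :
  linear g -> is_bilinear F -> linear (fun x => sweedler (g x) F).
Proof. by move=> gL FB a x y; rewrite gL; apply: sweedler_linear. Qed.

Lemma lin_scalel (g : X -> k^o) (v : V) :
  linear g -> linear (fun x => g x *: v).
Proof. by move=> gL a x y; rewrite gL scalerDl scalerA. Qed.

Lemma lin_scaler (b : k) (g : X -> V) : linear g -> linear (fun x => b *: g x).
Proof.
by move=> gL a x y; rewrite gL scalerDr !scalerA [b * a]mulrC.
Qed.

Lemma sweedlerC (Y Z : lmodType k) (z : U ⊗ V) (w : Y ⊗ Z)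
    (F : U -> V -> Y -> Z -> W) :
  \sw_(u ⊗ v <- z) \sw_(y ⊗ t <- w) F u v y t =
  \sw_(y ⊗ t <- w) \sw_(u ⊗ v <- z) F u v y t.
Proof. exact: exchange_big. Qed.

Lemma sweedlerZ (a : k) (z : U ⊗ V) (F : U -> V -> W) :
  \sw_(u ⊗ v <- z) a *: F u v = a *: \sw_(u ⊗ v <- z) F u v.
Proof. by rewrite /sweedler /formal_eval scaler_sumr. Qed.

Lemma tensZl a (u : U) (v : V) : (a *: u) ⊗ v = a *: (u ⊗ v).
Proof. exact: (scalable_linear ((tens_bilinear U V).1 v)). Qed.

Lemma tensZr a (u : U) (v : V) : u ⊗ (a *: v) = a *: (u ⊗ v).
Proof. exact: (scalable_linear ((tens_bilinear U V).2 u)). Qed.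

Lemma sweedler_sweedler (Y Z : lmodType k) (z : Y ⊗ Z)
    (G : Y -> Z -> U ⊗ V) (F : U -> V -> W) : is_bilinear F ->
  sweedler (sweedler z G) F = \sw_(y ⊗ t <- z) sweedler (G y t) F.
Proof.
move=> FB; exact: (sweedler_apply z G (sweedler_linear FB)).
Qed.

Lemma tens_sweedlerl (Y Z : lmodType k) (z : Y ⊗ Z) (G : Y -> Z -> U) (v : V) :
  sweedler z G ⊗ v = \sw_(y ⊗ t <- z) G y t ⊗ v.
Proof. exact: (sweedler_apply z G (fun a => (tens_bilinear U V).1 v a)). Qed.

Lemma tens_sweedlerr (Y Z : lmodType k) (z : Y ⊗ Z) (G : Y -> Z -> V) (u : U) :
  u ⊗ sweedler z G = \sw_(y ⊗ t <- z) u ⊗ G y t.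
Proof. exact: (sweedler_apply z G (fun a => (tens_bilinear U V).2 u a)). Qed.

End LinearityLemmas.

Ltac lin :=
  lazymatch goal with
  | |- bilinear_for _ _ _ => split=> ?; lin
  | |- _ => cbn beta; first
     [ exact: lin_id
     | apply: lin_tensl; lin
     | apply: lin_tensr; lin
     | apply: lin_scalel; lin
     | apply: lin_scaler; lin
     | apply: sweedler_linear_param => ? ?; lin
     | apply: lin_sweedler; lin
     | apply: lin_comp; lin
     | exact: linearP ]
  end.

HB.mixin Record Lmodule_isCoalgebra (k : fieldType) C of GRing.Lmodule k C := {
  comul : {linear C -> (C ⊗ C)%type};
  counit : {linear C -> k^o};
  comulA : forall c : C,
    \sw_(c1 ⊗ c2 <- comul c) comul c1 ⊗ c2 =
    \sw_(c1 ⊗ c2 <- comul c) \sw_(c21 ⊗ c22 <- comul c2) (c1 ⊗ c21) ⊗ c22;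
  counitl : forall c : C, \sw_(c1 ⊗ c2 <- comul c) counit c1 *: c2 = c;
  counitr : forall c : C, \sw_(c1 ⊗ c2 <- comul c) counit c2 *: c1 = c
}.

#[short(type="coalgType")]
HB.structure Definition Coalgebra (k : fieldType) :=
  { C of GRing.Lmodule k C & Lmodule_isCoalgebra k C }.

Section CoalgebraTheory.
Variables (k : fieldType) (C : coalgType k) (W : lmodType k).

Lemma comulA_sweedler (F : C -> C -> C -> W) (c : C) :
  (forall y z, linear (fun x => F x y z)) ->
  (forall x z, linear (fun y => F x y z)) ->
  (forall x y, linear (fun z => F x y z)) ->
  \sw_(c1 ⊗ c2 <- comul c) \sw_(c11 ⊗ c12 <- comul c1) F c11 c12 c2 =
  \sw_(c1 ⊗ c2 <- comul c) \sw_(c21 ⊗ c22 <- comul c2) F c1 c21 c22.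
Proof.
move=> F1 F2 F3.
pose G (z : (C ⊗ C) ⊗ C) := \sw_(x ⊗ y ⊗ z <- z) F x y z.
have F12 z : is_bilinear (fun x y => F x y z) by split=> ?; auto.
have GB : is_bilinear (fun (ab : C ⊗ C) c => \sw_(a ⊗ b <- ab) F a b c).
  split=> [z|ab]; first exact: sweedler_linear.
  by apply: sweedler_linear_param => ? ?; auto.
have GL : linear G by exact: sweedler_linear.
have := congr1 G (comulA c); rewrite !sweedler_apply // => E.
transitivity (\sw_(c1 ⊗ c2 <- comul c) G (comul c1 ⊗ c2)).
  by apply: eq_sweedler => c1 c2; rewrite /G sweedler_tens.
rewrite {}E; apply: eq_sweedler => c1 c2.
rewrite sweedler_apply //; apply: eq_sweedler => c21 c22.
by rewrite /G sweedler_tens // sweedler_tens.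
Qed.

Lemma counitl_sweedler (F : C -> W) (c : C) : linear F ->
  \sw_(c1 ⊗ c2 <- comul c) counit c1 *: F c2 = F c.
Proof.
move=> FL; rewrite -[in RHS](counitl c) sweedler_apply //.
apply: eq_sweedler => c1 c2.
by rewrite (scalable_linear FL).
Qed.

Lemma counitr_sweedler (F : C -> W) (c : C) : linear F ->
  \sw_(c1 ⊗ c2 <- comul c) counit c2 *: F c1 = F c.
Proof.
move=> FL; rewrite -[in RHS](counitr c) sweedler_apply //.
apply: eq_sweedler => c1 c2.
by rewrite (scalable_linear FL).
Qed.

End CoalgebraTheory.

Definition comul3 (k : fieldType) (C : coalgType k) (c : C) : (C ⊗ C) ⊗ C :=
  \sw_(c1 ⊗ c2 <- comul c) comul c1 ⊗ c2.

Definition comul4 (k : fieldType) (C : coalgType k) (c : C) :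
    ((C ⊗ C) ⊗ C) ⊗ C :=
  \sw_(c1 ⊗ c2 <- comul c) comul3 c1 ⊗ c2.

Definition grouplike (k : fieldType) (C : coalgType k) (x : C) : Prop :=
  comul x = x ⊗ x /\ counit x = 1.

Definition coalgebra_map (k : fieldType) (C D : coalgType k)
    (f : {linear C -> D}) : Prop :=
  (forall c, comul (f c) = tensor_map f f (comul c)) /\
  (forall c, counit (f c) = counit c).

(* Same carrier as C.  Whenever an element of C is also used as an element of
   C^cop, its Sweedler components below are those of C. *)
Definition cop (C : Type) : Type := C.
Notation "C ^cop" := (cop C) : type_scope.

Section Coopposite.
Variables (k : fieldType) (C : coalgType k).

HB.instance Definition _ := GRing.Lmodule.copy C^cop C.

Definition cop_comul (c : C^cop) : C^cop ⊗ C^cop :=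
  \sw_(c1 ⊗ c2 <- comul (c : C)) (c2 : C^cop) ⊗ (c1 : C^cop).

Fact cop_comul_linear : linear cop_comul.
Proof. rewrite /cop_comul; lin. Qed.
HB.instance Definition _ :=
  GRing.isLinear.Build _ _ _ _ cop_comul cop_comul_linear.

Lemma sweedler_cop (W : lmodType k) (F : C -> C -> W) (c : C) :
  is_bilinear F ->
  \sw_(c1 ⊗ c2 <- cop_comul c) F c1 c2 = \sw_(c1 ⊗ c2 <- comul c) F c2 c1.
Proof.
move=> FB; rewrite sweedler_sweedler //.
by apply: eq_sweedler => c1 c2; rewrite sweedler_tens.
Qed.

Fact cop_comulA (c : C^cop) :
  \sw_(c1 ⊗ c2 <- cop_comul c) cop_comul c1 ⊗ c2 =
  \sw_(c1 ⊗ c2 <- cop_comul c) \sw_(c21 ⊗ c22 <- cop_comul c2)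
    (c1 ⊗ c21) ⊗ c22.
Proof.
rewrite !sweedler_cop; try by lin.
under eq_sweedler do rewrite tens_sweedlerl.
symmetry; under eq_sweedler => c1 c2.
  rewrite (sweedler_cop (F := fun x y => (c2 ⊗ x) ⊗ y)); last by lin.
  over.
by rewrite (comulA_sweedler (F := fun x y z => (z ⊗ y) ⊗ x)) //= => *; lin.
Qed.

Fact cop_counitl (c : C^cop) :
  \sw_(c1 ⊗ c2 <- cop_comul c) counit (c1 : C) *: c2 = c.
Proof. by rewrite sweedler_cop ?[LHS]counitr //; lin. Qed.

Fact cop_counitr (c : C^cop) :
  \sw_(c1 ⊗ c2 <- cop_comul c) counit (c2 : C) *: c1 = c.
Proof. by rewrite sweedler_cop ?[LHS]counitl //; lin. Qed.

HB.instance Definition _ := Lmodule_isCoalgebra.Build k C^cop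
  cop_comulA cop_counitl cop_counitr.

End Coopposite.

Section TensorCoalgebra.
Variables (k : fieldType) (C D : coalgType k).

Definition tensor_comul (z : C ⊗ D) : (C ⊗ D) ⊗ (C ⊗ D) :=
  \sw_(c ⊗ d <- z) \sw_(c1 ⊗ c2 <- comul c) \sw_(d1 ⊗ d2 <- comul d)
    (c1 ⊗ d1) ⊗ (c2 ⊗ d2).

Definition tensor_counit (z : C ⊗ D) : k^o :=
  \sw_(c ⊗ d <- z) counit c *: counit d.

Fact tensor_comul_linear : linear tensor_comul.
Proof. rewrite /tensor_comul; lin. Qed.
HB.instance Definition _ :=
  GRing.isLinear.Build _ _ _ _ tensor_comul tensor_comul_linear.

Fact tensor_counit_linear : linear tensor_counit.
Proof. rewrite /tensor_counit; lin. Qed.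
HB.instance Definition _ :=
  GRing.isLinear.Build _ _ _ _ tensor_counit tensor_counit_linear.

Lemma tensor_comul_tens c d : tensor_comul (c ⊗ d) =
  \sw_(c1 ⊗ c2 <- comul c) \sw_(d1 ⊗ d2 <- comul d)
    (c1 ⊗ d1) ⊗ (c2 ⊗ d2).
Proof. by rewrite /tensor_comul sweedler_tens //; lin. Qed.

Lemma tensor_counit_tens c d :
  tensor_counit (c ⊗ d) = counit c *: counit d.
Proof. by rewrite /tensor_counit sweedler_tens //; lin. Qed.

Lemma sweedler_tensor_comul (W : lmodType k) (F : C ⊗ D -> C ⊗ D -> W) c d :
  is_bilinear F ->
  \sw_(x ⊗ y <- tensor_comul (c ⊗ d)) F x y =
  \sw_(c1 ⊗ c2 <- comul c) \sw_(d1 ⊗ d2 <- comul d) F (c1 ⊗ d1) (c2 ⊗ d2).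
Proof.
move=> FB; rewrite tensor_comul_tens sweedler_sweedler //.
apply: eq_sweedler => c1 c2; rewrite sweedler_sweedler //.
by apply: eq_sweedler => d1 d2; rewrite sweedler_tens.
Qed.

Fact tensor_comulA (z : C ⊗ D) :
  \sw_(x ⊗ y <- tensor_comul z) tensor_comul x ⊗ y =
  \sw_(x ⊗ y <- tensor_comul z) \sw_(y1 ⊗ y2 <- tensor_comul y)
    (x ⊗ y1) ⊗ y2.
Proof.
move: z; apply: tensor_linear_ext; [by lin|by lin|move=> c d].
rewrite !sweedler_tensor_comul; try by lin.
pose G a1 a2 a3 b1 b2 b3 : ((C ⊗ D) ⊗ (C ⊗ D)) ⊗ (C ⊗ D) :=
  ((a1 ⊗ b1) ⊗ (a2 ⊗ b2)) ⊗ (a3 ⊗ b3).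
transitivity (\sw_(c1 ⊗ c2 <- comul c) \sw_(c11 ⊗ c12 <- comul c1)
   \sw_(d1 ⊗ d2 <- comul d) \sw_(d11 ⊗ d12 <- comul d1)
   G c11 c12 c2 d11 d12 d2).
  apply: eq_sweedler => c1 c2; rewrite sweedlerC; apply: eq_sweedler => d1 d2.
  rewrite tensor_comul_tens tens_sweedlerl; apply: eq_sweedler => c11 c12.
  by rewrite tens_sweedlerl.
rewrite (comulA_sweedler (F := fun a1 a2 a3 =>
   \sw_(d1 ⊗ d2 <- comul d) \sw_(d11 ⊗ d12 <- comul d1)
     G a1 a2 a3 d11 d12 d2)); rewrite /G; try by move=> *; lin.
apply: eq_sweedler => c1 c2.
under [RHS]eq_sweedler => d1 d2.
  rewrite (sweedler_tensor_comul (F := fun x y => ((c1 ⊗ d1) ⊗ x) ⊗ y));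
    last by lin.
  over.
rewrite [RHS]sweedlerC; apply: eq_sweedler => c21 c22.
by rewrite (comulA_sweedler (F := fun b1 b2 b3 => G c1 c21 c22 b1 b2 b3));
  rewrite /G //; move=> *; lin.
Qed.

Fact tensor_counitl (z : C ⊗ D) :
  \sw_(x ⊗ y <- tensor_comul z) tensor_counit x *: y = z.
Proof.
move: z; apply: tensor_linear_ext; [by lin|by lin|move=> c d].
rewrite sweedler_tensor_comul; last by lin.
rewrite -[in RHS](counitl c) tens_sweedlerl; apply: eq_sweedler => c1 c2.
rewrite -[in RHS](counitl d) tens_sweedlerr; apply: eq_sweedler => d1 d2.
by rewrite tensor_counit_tens tensZl tensZr scalerA.
Qed.

Fact tensor_counitr (z : C ⊗ D) :
  \sw_(x ⊗ y <- tensor_comul z) tensor_counit y *: x = z.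
Proof.
move: z; apply: tensor_linear_ext; [by lin|by lin|move=> c d].
rewrite sweedler_tensor_comul; last by lin.
rewrite -[in RHS](counitr c) tens_sweedlerl; apply: eq_sweedler => c1 c2.
rewrite -[in RHS](counitr d) tens_sweedlerr; apply: eq_sweedler => d1 d2.
by rewrite tensor_counit_tens tensZl tensZr scalerA.
Qed.

HB.instance Definition _ := Lmodule_isCoalgebra.Build k (C ⊗ D)%type
  tensor_comulA tensor_counitl tensor_counitr.

End TensorCoalgebra.

HB.mixin Record Coalgebra_isHopfHeap (k : fieldType) C of Coalgebra k C := {
  heap : {linear ((C ⊗ C^cop) ⊗ C)%type -> C};
  heap_coalgebra_map : coalgebra_map heap;
  heapA : forall a b c d h : C,
    heap ((heap ((a ⊗ b) ⊗ c) ⊗ d) ⊗ h) =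
    heap ((a ⊗ b) ⊗ heap ((c ⊗ d) ⊗ h));
  heapKl : forall c a : C,
    \sw_(c1 ⊗ c2 <- comul c) heap ((c1 ⊗ c2) ⊗ a) = counit c *: a;
  heapKr : forall c a : C,
    \sw_(c1 ⊗ c2 <- comul c) heap ((a ⊗ c1) ⊗ c2) = counit c *: a
}.

#[short(type="hopfHeapType")]
HB.structure Definition HopfHeap (k : fieldType) :=
  { C of Coalgebra k C & Coalgebra_isHopfHeap k C }.

Notation "⟦ a , b , c ⟧" := (heap ((a ⊗ b) ⊗ c)) : ring_scope.

Definition commutative_heap (k : fieldType) (C : hopfHeapType k) : Prop :=
  forall x y z : C, ⟦x, y, z⟧ = ⟦z, y, x⟧.

Definition rota_baxter_operator (k : fieldType) (C : hopfHeapType k)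
    (B : {linear C -> C}) : Prop :=
  (forall a b c : C, B ⟦a, b, c⟧ = ⟦B a, B b, B c⟧) /\
  (forall a : C,
     \sw_(a1 ⊗ a2 <- comul a) B a1 ⊗ B a2 =
     \sw_(b1 ⊗ b2 ⊗ b3 ⊗ b4 <- comul4 (B a)) ⟦b1, B b4, B b2⟧ ⊗ b3).

HB.mixin Record Lmodule_isComodule (k : fieldType) (H : coalgType k) M
    of GRing.Lmodule k M := {
  coact : {linear M -> (M ⊗ H)%type};
  coactA : forall m : M,
    \sw_(m0 ⊗ m1 <- coact m) coact m0 ⊗ m1 =
    \sw_(m0 ⊗ m1 <- coact m) \sw_(h1 ⊗ h2 <- comul m1) (m0 ⊗ h1) ⊗ h2;
  coact_counit : forall m : M,
    \sw_(m0 ⊗ m1 <- coact m) counit m1 *: m0 = m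
}.

#[short(type="comodType")]
HB.structure Definition Comodule (k : fieldType) (H : coalgType k) :=
  { M of GRing.Lmodule k M & Lmodule_isComodule k H M }.

HB.mixin Record Comodule_isHeapModule (k : fieldType) (H : hopfHeapType k) M
    of Comodule k H M := {
  hact : {linear (M ⊗ (H^cop ⊗ H))%type -> M};
  hactA : forall (m : M) (a b c d : H),
    hact (m ⊗ (a ⊗ ⟦b, c, d⟧)) = hact (hact (m ⊗ (a ⊗ b)) ⊗ (c ⊗ d));
  hactK : forall (m : M) (c : H),
    \sw_(c1 ⊗ c2 <- comul c) hact (m ⊗ (c1 ⊗ c2)) = counit c *: m;
  coact_hact : forall (m : M) (c d : H),
    coact (hact (m ⊗ (c ⊗ d))) =
    \sw_(m0 ⊗ m1 <- coact m) \sw_(c1 ⊗ c2 <- comul c)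
      \sw_(d1 ⊗ d2 <- comul d) hact (m0 ⊗ (c2 ⊗ d1)) ⊗ ⟦m1, c1, d2⟧
}.

#[short(type="heapModType")]
HB.structure Definition HeapModule (k : fieldType) (H : hopfHeapType k) :=
  { M of Comodule k H M & Comodule_isHeapModule k H M }.

Notation "m ◁ t" := (hact (m ⊗ t)) : ring_scope.

Section HopfHeapTheory.
Variables (k : fieldType) (H : hopfHeapType k).

Lemma comul_heap (a b c : H) : comul ⟦a, b, c⟧ =
  \sw_(a1 ⊗ a2 <- comul a) \sw_(b1 ⊗ b2 <- comul b) \sw_(c1 ⊗ c2 <- comul c)
    ⟦a1, b2, c1⟧ ⊗ ⟦a2, b1, c2⟧.
Proof.
have [-> _] := heap_coalgebra_map (s := H).
rewrite /tensor_map [LHS](sweedler_tensor_comul (C := (H ⊗ H^cop)%type));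
  last by lin.
rewrite (sweedler_tensor_comul (D := H^cop)); last by lin.
apply: eq_sweedler => a1 a2; rewrite sweedler_cop //; last by lin.
Qed.

Lemma counit_heap (a b c : H) :
  counit ⟦a, b, c⟧ = counit a * counit b * counit c.
Proof.
have [_ ->] := heap_coalgebra_map (s := H).
rewrite [LHS](tensor_counit_tens (C := (H ⊗ H^cop)%type)).
by congr (_ * _); exact: (tensor_counit_tens (D := H^cop)).
Qed.

End HopfHeapTheory.

(* For every vector space V, the right H-Hopf heap module V ⊗ H with
   v ⊗ h |-> (v ⊗ h1) ⊗ h2 and (v ⊗ h) ◁ (g ⊗ l) = v ⊗ [h, g, l]. *)
Section FreeHeapModule.
Variables (k : fieldType) (V : lmodType k) (H : hopfHeapType k).

Definition free_coact (w : V ⊗ H) : (V ⊗ H) ⊗ H :=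
  \sw_(v ⊗ h <- w) \sw_(h1 ⊗ h2 <- comul h) (v ⊗ h1) ⊗ h2.

Definition free_act (z : (V ⊗ H) ⊗ (H^cop ⊗ H)) : V ⊗ H :=
  \sw_(w ⊗ t <- z) \sw_(v ⊗ h <- w) \sw_(g ⊗ l <- t)
    v ⊗ heap ((h ⊗ g) ⊗ l).

Fact free_coact_linear : linear free_coact.
Proof. rewrite /free_coact; lin. Qed.
HB.instance Definition _ :=
  GRing.isLinear.Build _ _ _ _ free_coact free_coact_linear.

Fact free_act_linear : linear free_act.
Proof. rewrite /free_act; lin. Qed.
HB.instance Definition _ :=
  GRing.isLinear.Build _ _ _ _ free_act free_act_linear.

Lemma free_coact_tens v h :
  free_coact (v ⊗ h) = \sw_(h1 ⊗ h2 <- comul h) (v ⊗ h1) ⊗ h2.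
Proof. by rewrite /free_coact sweedler_tens //; lin. Qed.

Lemma free_act_tens v h g l :
  free_act ((v ⊗ h) ⊗ (g ⊗ l)) = v ⊗ ⟦h, g, l⟧.
Proof. by rewrite /free_act !sweedler_tens //; lin. Qed.

Lemma sweedler_free_coact (W : lmodType k) (F : V ⊗ H -> H -> W) v h :
  is_bilinear F ->
  \sw_(x ⊗ y <- free_coact (v ⊗ h)) F x y =
  \sw_(h1 ⊗ h2 <- comul h) F (v ⊗ h1) h2.
Proof.
move=> FB; rewrite free_coact_tens sweedler_sweedler //.
by apply: eq_sweedler => h1 h2; rewrite sweedler_tens.
Qed.

Fact free_coactA (w : V ⊗ H) :
  \sw_(x ⊗ y <- free_coact w) free_coact x ⊗ y =
  \sw_(x ⊗ y <- free_coact w) \sw_(h1 ⊗ h2 <- comul y) (x ⊗ h1) ⊗ h2.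
Proof.
move: w; apply: tensor_linear_ext; [by lin|by lin|move=> v h].
rewrite !sweedler_free_coact; try by lin.
under eq_sweedler do rewrite free_coact_tens tens_sweedlerl.
rewrite (comulA_sweedler (F := fun x y z => ((v ⊗ x) ⊗ y) ⊗ z)) //;
  by move=> *; lin.
Qed.

Fact free_coact_counit (w : V ⊗ H) :
  \sw_(x ⊗ y <- free_coact w) counit y *: x = w.
Proof.
move: w; apply: tensor_linear_ext; [by lin|by lin|move=> v h].
rewrite sweedler_free_coact; last by lin.
by rewrite (counitr_sweedler (F := fun x => v ⊗ x)) //; lin.
Qed.

HB.instance Definition _ := Lmodule_isComodule.Build k H (V ⊗ H)%type
  free_coactA free_coact_counit.

Fact free_actA (w : V ⊗ H) (a b c d : H) :
  free_act (w ⊗ (a ⊗ ⟦b, c, d⟧)) = free_act (free_act (w ⊗ (a ⊗ b)) ⊗ (c ⊗ d)).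
Proof.
move: w; apply: tensor_linear_ext; [by lin|by lin|move=> v h].
by rewrite !free_act_tens heapA.
Qed.

Fact free_actK (w : V ⊗ H) (c : H) :
  \sw_(c1 ⊗ c2 <- comul c) free_act (w ⊗ (c1 ⊗ c2)) = (counit c : k) *: w.
Proof.
move: w; apply: tensor_linear_ext; [by lin|by lin|move=> v h].
under eq_sweedler do rewrite free_act_tens.
by rewrite -tens_sweedlerr heapKr tensZr.
Qed.

Fact free_coact_act (w : V ⊗ H) (c d : H) :
  free_coact (free_act (w ⊗ (c ⊗ d))) =
  \sw_(x ⊗ y <- free_coact w) \sw_(c1 ⊗ c2 <- comul c)
    \sw_(d1 ⊗ d2 <- comul d) free_act (x ⊗ (c2 ⊗ d1)) ⊗ ⟦y, c1, d2⟧.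
Proof.
move: w; apply: tensor_linear_ext; [by lin|by lin|move=> v h].
rewrite sweedler_free_coact; last by lin.
rewrite free_act_tens free_coact_tens comul_heap.
rewrite sweedler_sweedler; last by lin.
apply: eq_sweedler => h1 h2; rewrite sweedler_sweedler; last by lin.
apply: eq_sweedler => c1 c2; rewrite sweedler_sweedler; last by lin.
apply: eq_sweedler => d1 d2; rewrite sweedler_tens; last by lin.
by rewrite free_act_tens.
Qed.

HB.instance Definition _ := Comodule_isHeapModule.Build k H (V ⊗ H)%type
  free_actA free_actK free_coact_act.

End FreeHeapModule.

Section Modules.
Variables (k : fieldType) (H : hopfHeapType k).

Definition heap_module_morphism (M N : heapModType H) (f : {linear M -> N}) :
    Prop :=
  (forall m, coact (f m) = tensor_map f idfun (coact m)) /\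
  (forall m (a b : H), f (m ◁ (a ⊗ b)) = f m ◁ (a ⊗ b)).

Definition rota_baxter_module (B : {linear H -> H}) (M : heapModType H)
    (T : {linear M -> M}) : Prop :=
  forall m : M,
    \sw_(m0 ⊗ m1 <- coact m) T m0 ⊗ B m1 =
    \sw_(t0 ⊗ t1 <- coact (T m)) \sw_(h1 ⊗ h2 ⊗ h3 <- comul3 t1)
      (t0 ◁ (B h3 ⊗ B h1)) ⊗ h2.

Definition rota_baxter_module_morphism (M N : heapModType H)
    (TM : {linear M -> M}) (TN : {linear N -> N}) (f : {linear M -> N}) : Prop :=
  heap_module_morphism f /\ f \o TM =1 TN \o f.

Definition rota_baxter_module_isomorphic (M N : heapModType H)
    (TM : {linear M -> M}) (TN : {linear N -> N}) : Prop :=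
  exists (f : {linear M -> N}) (g : {linear N -> M}),
    [/\ rota_baxter_module_morphism TM TN f,
        rota_baxter_module_morphism TN TM g, cancel f g & cancel g f].

End Modules.

Section Coinvariants.
Variables (k : fieldType) (H : hopfHeapType k) (M : heapModType H) (x : H).

Definition coinvariant : {pred M} := fun m => coact m == m ⊗ x.

Fact coinvariant_submod_closed : submod_closed coinvariant.
Proof.
split=> [|a m n]; rewrite !unfold_in.
  by rewrite linear0 -[0 in X in _ == X](scale0r 0) tensZl scale0r.
move=> /eqP mP /eqP nP.
by rewrite linearP mP nP ((tens_bilinear _ _).1 x).
Qed.
HB.instance Definition _ :=
  GRing.isSubmodClosed.Build k M coinvariant coinvariant_submod_closed.

Definition coinv : Type := {m : M | m \in coinvariant}.
HB.instance Definition _ := SubChoice.on coinv.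
HB.instance Definition _ := [SubChoice_isSubLmodule of coinv by <:].

Definition coinv_incl (w : coinv ⊗ H) : M ⊗ H := tensor_map val idfun w.

Definition coinv_proj (m : M) : M :=
  \sw_(m0 ⊗ m1 <- coact m) m0 ◁ (m1 ⊗ x).

Fact coinv_proj_linear : linear coinv_proj.
Proof. rewrite /coinv_proj; lin. Qed.
HB.instance Definition _ :=
  GRing.isLinear.Build _ _ _ _ coinv_proj coinv_proj_linear.

Lemma coactA_sweedler (W : lmodType k) (F : M -> H -> H -> W) (m : M) :
  (forall y z, linear (fun x => F x y z)) ->
  (forall x z, linear (fun y => F x y z)) ->
  (forall x y, linear (fun z => F x y z)) ->
  \sw_(m0 ⊗ m1 <- coact m) \sw_(n0 ⊗ n1 <- coact m0) F n0 n1 m1 =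
  \sw_(m0 ⊗ m1 <- coact m) \sw_(h1 ⊗ h2 <- comul m1) F m0 h1 h2.
Proof.
move=> F1 F2 F3.
have F12 z : is_bilinear (fun x y => F x y z) by split=> ?; auto.
have GB : is_bilinear (fun (ab : M ⊗ H) c => \sw_(a ⊗ b <- ab) F a b c).
  split=> [z|ab]; first exact: sweedler_linear.
  by apply: sweedler_linear_param => ? ?; auto.
pose G (z : (M ⊗ H) ⊗ H) := \sw_(x ⊗ y ⊗ z <- z) F x y z.
have GL : linear G by exact: sweedler_linear.
have := congr1 G (coactA m); rewrite !sweedler_apply // => E.
transitivity (\sw_(m0 ⊗ m1 <- coact m) G (coact m0 ⊗ m1)).
  by apply: eq_sweedler => m0 m1; rewrite /G sweedler_tens.
rewrite {}E; apply: eq_sweedler => m0 m1.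
rewrite sweedler_apply //; apply: eq_sweedler => h1 h2.
by rewrite /G sweedler_tens // sweedler_tens.
Qed.

Hypothesis xG : grouplike x.

Lemma coinv_proj_coinvariant m : coinv_proj m \in coinvariant.
Proof.
apply/eqP; rewrite {1}/coinv_proj.
rewrite (sweedler_apply _ _ (f := coact)); last exact: linearP.
transitivity (\sw_(m0 ⊗ m1 <- coact m) \sw_(n0 ⊗ n1 <- coact m0)
    \sw_(c1 ⊗ c2 <- comul m1) (n0 ◁ (c2 ⊗ x)) ⊗ ⟦n1, c1, x⟧).
  apply: eq_sweedler => m0 m1; rewrite coact_hact.
  apply: eq_sweedler => n0 n1; apply: eq_sweedler => c1 c2.
  by rewrite xG.1 sweedler_tens //; lin.
rewrite (coactA_sweedler (F := fun n0 n1 m1 => \sw_(c1 ⊗ c2 <- comul m1)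
  (n0 ◁ (c2 ⊗ x)) ⊗ ⟦n1, c1, x⟧)); try by move=> *; lin.
rewrite tens_sweedlerl; apply: eq_sweedler => m0 m1.
rewrite -(comulA_sweedler (F := fun a b c : H =>
  (m0 ◁ (c ⊗ x)) ⊗ ⟦a, b, x⟧)); try by move=> *; lin.
under eq_sweedler do rewrite -tens_sweedlerr heapKl tensZr.
by rewrite (counitl_sweedler (F := fun c : H => (m0 ◁ (c ⊗ x)) ⊗ x)) //; lin.
Qed.

Lemma coinv_proj_id m : m \in coinvariant -> coinv_proj m = m.
Proof.
move=> /eqP mP; rewrite /coinv_proj mP sweedler_tens; last by lin.
have := hactK m x; rewrite xG.1 xG.2 scale1r sweedler_tens //; lin.
Qed.

Definition coinv_retract (m : M) : coinv :=
  exist _ (coinv_proj m) (coinv_proj_coinvariant m).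

Fact coinv_retract_linear : linear coinv_retract.
Proof. by move=> a m n; apply: val_inj; rewrite /= coinv_proj_linear. Qed.
HB.instance Definition _ :=
  GRing.isLinear.Build _ _ _ _ coinv_retract coinv_retract_linear.

(* coinv M x ⊗ H is thus identified with a subspace of M ⊗ H, and a map of
   M ⊗ H has at most one restriction to it. *)
Lemma coinv_incl_inj : injective coinv_incl.
Proof.
apply: (can_inj (g := tensor_map coinv_retract idfun)) => w.
move: w; apply: tensor_linear_ext => [| |m h].
- rewrite /coinv_incl /tensor_map; lin.
- by lin.
rewrite /coinv_incl /tensor_map sweedler_tens; last by lin.
rewrite sweedler_tens; last by lin.
by congr (_ ⊗ _); apply: val_inj; rewrite /= coinv_proj_id // (valP m).
Qed.

Variables (B : {linear H -> H}) (T : {linear M -> M}).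

Definition hatT (z : M ⊗ H) : M ⊗ H :=
  \sw_(m ⊗ h <- z) \sw_(h1 ⊗ h2 <- comul h)
    \sw_(t0 ⊗ t1 <- coact (T (m ◁ (x ⊗ h1)))) (t0 ◁ (t1 ⊗ x)) ⊗ B h2.

Fact hatT_linear : linear hatT.
Proof. rewrite /hatT; lin. Qed.
HB.instance Definition _ := GRing.isLinear.Build _ _ _ _ hatT hatT_linear.

Lemma hatT_tens m h : hatT (m ⊗ h) =
  \sw_(h1 ⊗ h2 <- comul h)
    \sw_(t0 ⊗ t1 <- coact (T (m ◁ (x ⊗ h1)))) (t0 ◁ (t1 ⊗ x)) ⊗ B h2.
Proof. by rewrite /hatT sweedler_tens //; lin. Qed.

End Coinvariants.

(* Main.v *)
(** For a coinvariant [v], the element [v ◁ (x ⊗ h)] behaves like [v ⊗ h], so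
    that [v ⊗ h |-> v ◁ (x ⊗ h)] is an isomorphism from [coinv M x ⊗ H] onto
    [M], with inverse [m |-> E m0 ⊗ m1] where [E = coinv_proj x].  Through it
    [E] becomes [id ⊗ counit], hence
    [E (m ◁ (a ⊗ b)) = counit a * counit b * E m].  Applying [E ⊗ id] to the
    Rota-Baxter identity of [T], both factors [B] disappear when [B] preserves
    the counit; what remains says that the isomorphism intertwines [T] with
    [hatT]. *)
From HB Require Import structures.
Require Import Defs.
From mathcomp Require Import all_boot all_algebra.

Set Implicit Arguments.
Unset Strict Implicit.
Unset Printing Implicit Defensive.

Import GRing.Theory.
Local Open Scope ring_scope.

Section Morphisms.
Variables (k : fieldType) (H : hopfHeapType k).

(** Lets [coinv_split] inherit the morphism laws from its inverse [coinv_act], which is easy to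
    evaluate on pure tensors. *)
Lemma heap_module_morphism_inv (M N : heapModType H) (f : {linear M -> N})
    (g : {linear N -> M}) :
  heap_module_morphism f -> cancel f g -> cancel g f -> heap_module_morphism g.
Proof.
move=> [fco fact] fK gK; split=> [n|n a b]; last first.
  by rewrite -{1}(gK n) -fact fK.
rewrite -{2}(gK n) fco /tensor_map sweedler_sweedler; last by lin.
rewrite -[LHS]sweedler_id; apply: eq_sweedler => m0 m1.
by rewrite sweedler_tens ?fK //; lin.
Qed.

(** Apply [f ⊗ id] to the identity of [TM] at [g n]: since [f] respects coaction, action and
    operators, the result is the identity of [TN] at [f (g n) = n]. This replaces a direct
    verification for the restriction of [hatT]. *)
Lemma rota_baxter_module_transport (M N : heapModType H) (B : {linear H -> H})
    (TM : {linear M -> M}) (TN : {linear N -> N}) (f : {linear M -> N})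
    (g : {linear N -> M}) :
  rota_baxter_module_morphism TM TN f -> cancel g f ->
  rota_baxter_module B TM -> rota_baxter_module B TN.
Proof.
move=> [[fco fact] fT] gK TB n.
rewrite -(gK n) -[TN (f _)]fT !fco /tensor_map.
rewrite !sweedler_sweedler; try by lin.
have fL : linear (fun z : M ⊗ H => \sw_(u ⊗ v <- z) f u ⊗ v) by lin.
transitivity (\sw_(u ⊗ v <- \sw_(m0 ⊗ m1 <- coact (g n)) TM m0 ⊗ B m1) f u ⊗ v).
  rewrite (sweedler_apply _ _ fL); apply: eq_sweedler => m0 m1.
  rewrite !sweedler_tens; try by lin.
  by rewrite -[TN (f _)]fT.
rewrite TB (sweedler_apply _ _ fL); apply: eq_sweedler => t0 t1.
rewrite [RHS]sweedler_tens; last by lin.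
rewrite (sweedler_apply _ _ fL); apply: eq_sweedler => h12 h3.
rewrite (sweedler_apply _ _ fL); apply: eq_sweedler => h1 h2.
by rewrite sweedler_tens ?fact //; lin.
Qed.

End Morphisms.

Section Structure.
Variables (k : fieldType) (H : hopfHeapType k) (M : heapModType H) (x : H).
Hypothesis xG : grouplike x.

Lemma heap_grouplikel (a : H) : ⟦x, x, a⟧ = a.
Proof.
have := heapKl x a; rewrite xG.1 xG.2 scale1r sweedler_tens //; lin.
Qed.

(** As [v] and [x] only contribute [x] to the right-hand factor, the coaction law produces
    [⟦x, x, h2⟧], which collapses to [h2]. *)
Lemma coact_coinvariant_act (v : M) (h : H) : v \in coinvariant x ->
  coact (v ◁ (x ⊗ h)) = \sw_(h1 ⊗ h2 <- comul h) (v ◁ (x ⊗ h1)) ⊗ h2.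
Proof.
move=> /eqP vP; rewrite coact_hact vP xG.1 sweedler_tens; last by lin.
rewrite sweedler_tens; last by lin.
by apply: eq_sweedler => h1 h2; rewrite heap_grouplikel.
Qed.

Lemma coinv_proj_act (v : M) (h : H) : v \in coinvariant x ->
  coinv_proj x (v ◁ (x ⊗ h)) = (counit h : k) *: v.
Proof.
move=> vP; rewrite /coinv_proj coact_coinvariant_act //.
rewrite sweedler_sweedler; last by lin.
(* By [hactA] the two successive actions merge into one; the bracket then sums to [counit h *: x],
   and [v ◁ (x ⊗ x) = v]. *)
transitivity (v ◁ (x ⊗ \sw_(h1 ⊗ h2 <- comul h) ⟦h1, h2, x⟧)).
  rewrite (sweedler_apply _ _ (f := fun z => v ◁ (x ⊗ z))); last by lin.
  by apply: eq_sweedler => h1 h2; rewrite sweedler_tens ?hactA //; lin.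
rewrite heapKl !tensZr linearZ /=; congr (_ *: _).
have := hactK v x; rewrite xG.1 xG.2 scale1r sweedler_tens //; lin.
Qed.

(** Coassociativity brings the summand to [(m0 ◁ (h1 ⊗ x)) ◁ (x ⊗ h2) = m0 ◁ (h1 ⊗ ⟦x, x, h2⟧) = m0
    ◁ (h1 ⊗ h2)], where [h1 ⊗ h2] comes from [m1]; [hactK] then gives [counit m1 *: m0]. *)
Lemma coinv_proj_recover (m : M) :
  \sw_(m0 ⊗ m1 <- coact m) (coinv_proj x m0 ◁ (x ⊗ m1)) = m.
Proof.
rewrite /coinv_proj.
transitivity (\sw_(m0 ⊗ m1 <- coact m) \sw_(n0 ⊗ n1 <- coact m0)
    ((n0 ◁ (n1 ⊗ x)) ◁ (x ⊗ m1))).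
  apply: eq_sweedler => m0 m1.
  by rewrite (sweedler_apply _ _ (f := fun z => z ◁ (x ⊗ m1))) //; lin.
rewrite (coactA_sweedler
  (F := fun n0 n1 m1 => (n0 ◁ (n1 ⊗ x)) ◁ (x ⊗ m1))); try by move=> *; lin.
rewrite -[RHS]coact_counit; apply: eq_sweedler => m0 m1.
rewrite -hactK; apply: eq_sweedler => h1 h2.
by rewrite -hactA heap_grouplikel.
Qed.

(** Expanding [m] by [coinv_proj_recover] reduces to a coinvariant acted on by [x ⊗ ⟦m1, a, b⟧];
    [coinv_proj_act] leaves the counit of this bracket, a product because [heap] is a coalgebra
    map. *)
Lemma coinv_proj_hact (m : M) (a b : H) :
  coinv_proj x (m ◁ (a ⊗ b)) = (counit a * counit b : k) *: coinv_proj x m.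
Proof.
rewrite -{1}(coinv_proj_recover m).
rewrite (sweedler_apply _ _ (f := fun z => coinv_proj x (z ◁ (a ⊗ b))));
  last by lin.
rewrite -[in RHS](coact_counit m).
rewrite (sweedler_apply _ _ (@coinv_proj_linear k H M x)) -sweedlerZ.
apply: eq_sweedler => m0 m1.
rewrite -hactA coinv_proj_act ?coinv_proj_coinvariant // counit_heap.
by rewrite linearZ scalerA -mulrA mulrC.
Qed.

Definition coinv_split (m : M) : coinv M x ⊗ H :=
  \sw_(m0 ⊗ m1 <- coact m) coinv_retract xG m0 ⊗ m1.

Fact coinv_split_linear : linear coinv_split.
Proof. rewrite /coinv_split; lin. Qed.
HB.instance Definition _ :=
  GRing.isLinear.Build _ _ _ _ coinv_split coinv_split_linear.

Definition coinv_act (w : coinv M x ⊗ H) : M :=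
  \sw_(v ⊗ h <- w) (val v ◁ (x ⊗ h)).

Fact coinv_act_linear : linear coinv_act.
Proof. rewrite /coinv_act; lin. Qed.
HB.instance Definition _ :=
  GRing.isLinear.Build _ _ _ _ coinv_act coinv_act_linear.

Lemma coinv_act_tens v h : coinv_act (v ⊗ h) = val v ◁ (x ⊗ h).
Proof. by rewrite /coinv_act sweedler_tens //; lin. Qed.

Lemma coinv_splitK : cancel coinv_split coinv_act.
Proof.
move=> m; rewrite /coinv_split (sweedler_apply _ _ coinv_act_linear).
rewrite -[RHS]coinv_proj_recover; apply: eq_sweedler => m0 m1.
exact: coinv_act_tens.
Qed.

Lemma coinv_actK : cancel coinv_act coinv_split.
Proof.
apply: tensor_linear_ext => [||v h]; [by lin|by lin|].
rewrite coinv_act_tens /coinv_split coact_coinvariant_act ?(valP v) //.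
rewrite sweedler_sweedler; last by lin.
rewrite -[in RHS](counitl h) tens_sweedlerr; apply: eq_sweedler => h1 h2.
rewrite sweedler_tens; last by lin.
rewrite tensZr -tensZl; congr (_ ⊗ _); apply: val_inj.
by rewrite /= coinv_proj_act ?(valP v).
Qed.

Lemma coinv_act_morphism : heap_module_morphism coinv_act.
Proof.
split=> [w|w a b]; move: w; apply: tensor_linear_ext => [| |v h].
- by lin.
- rewrite /tensor_map; lin.
- rewrite /= coinv_act_tens coact_coinvariant_act ?(valP v) // /tensor_map.
  rewrite sweedler_free_coact; last by lin.
  by apply: eq_sweedler => h1 h2; rewrite /= coinv_act_tens.
- by lin.
- by lin.
by rewrite /= free_act_tens !coinv_act_tens hactA.
Qed.

Lemma coinv_split_morphism : heap_module_morphism coinv_split.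
Proof.
exact: heap_module_morphism_inv coinv_act_morphism coinv_actK coinv_splitK.
Qed.

Lemma coinv_incl_split (m : M) :
  coinv_incl (coinv_split m) = \sw_(m0 ⊗ m1 <- coact m) coinv_proj x m0 ⊗ m1.
Proof.
rewrite /coinv_incl /coinv_split /tensor_map sweedler_sweedler; last by lin.
by apply: eq_sweedler => m0 m1; rewrite sweedler_tens //; lin.
Qed.

Variables (B : {linear H -> H}) (T : {linear M -> M}).

Lemma hatT_coinv (z : M ⊗ H) : exists w : coinv M x ⊗ H,
  hatT x B T z = coinv_incl w.
Proof.
(* The innermost sum of [hatT] is [coinv_proj x] of [T (m ◁ (x ⊗ h1))], so the witness takes
   [coinv_retract] there. *)
exists (\sw_(m ⊗ h <- z) \sw_(h1 ⊗ h2 <- comul h)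
  coinv_retract xG (T (m ◁ (x ⊗ h1))) ⊗ B h2).
have iL : linear (@coinv_incl k H M x) by rewrite /coinv_incl /tensor_map; lin.
rewrite (sweedler_apply _ _ iL); apply: eq_sweedler => m h.
rewrite (sweedler_apply _ _ iL); apply: eq_sweedler => h1 h2.
rewrite /coinv_incl /tensor_map sweedler_tens; last by lin.
by rewrite /= /coinv_proj tens_sweedlerl.
Qed.

Lemma hatT_coinv_split (m : M) :
  hatT x B T (coinv_incl (coinv_split m)) =
  \sw_(m0 ⊗ m1 <- coact m) coinv_proj x (T m0) ⊗ B m1.
Proof.
rewrite coinv_incl_split (sweedler_apply _ _ (hatT_linear x B T)).
transitivity (\sw_(m0 ⊗ m1 <- coact m) \sw_(h1 ⊗ h2 <- comul m1)
    coinv_proj x (T (coinv_proj x m0 ◁ (x ⊗ h1))) ⊗ B h2).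
  apply: eq_sweedler => m0 m1; rewrite hatT_tens.
  by apply: eq_sweedler => h1 h2; rewrite -tens_sweedlerl.
(* Coassociativity moves the splitting from [m1] to [m0], so that the argument of [T] sums to [m0]
   by [coinv_proj_recover]. *)
rewrite -(coactA_sweedler (F := fun a b c =>
  coinv_proj x (T (coinv_proj x a ◁ (x ⊗ b))) ⊗ B c)); try by move=> *; lin.
apply: eq_sweedler => m0 m1.
rewrite -[in RHS](coinv_proj_recover m0).
by rewrite (sweedler_apply _ _ (f := fun z => coinv_proj x (T z) ⊗ B m1)) //; lin.
Qed.

Hypothesis T_RB : rota_baxter_module B T.
Hypothesis counitB : forall h : H, counit (B h) = counit h.

Lemma hatT_intertwine (m : M) :
  hatT x B T (coinv_incl (coinv_split m)) = coinv_incl (coinv_split (T m)).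
Proof.
rewrite hatT_coinv_split coinv_incl_split.
have EL : linear (fun z : M ⊗ H => \sw_(u ⊗ v <- z) coinv_proj x u ⊗ v) by lin.
have := congr1 (fun z => \sw_(u ⊗ v <- z) coinv_proj x u ⊗ v) (T_RB m).
rewrite /= !(sweedler_apply _ _ EL).
under eq_sweedler => m0 m1.
  rewrite sweedler_tens; last by lin.
  over.
move=> ->; apply: eq_sweedler => t0 t1; rewrite (sweedler_apply _ _ EL).
transitivity (\sw_(h1 ⊗ h2 ⊗ h3 <- comul3 t1)
    (counit h3 : k) *: ((counit h1 : k) *: (coinv_proj x t0 ⊗ h2))).
  apply: eq_sweedler => h12 h3; rewrite (sweedler_apply _ _ EL).
  apply: eq_sweedler => h1 h2; rewrite sweedler_tens; last by lin.
  by rewrite coinv_proj_hact !counitB tensZl scalerA.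
(* The counits sit on the two outer legs of [comul3 t1]; removing them in turn leaves [t1] in the
   middle leg. *)
rewrite /comul3 sweedler_sweedler; last by lin.
under eq_sweedler => h12 h3.
  rewrite sweedler_tens; last by lin.
  rewrite sweedlerZ (counitl_sweedler (F := fun h => coinv_proj x t0 ⊗ h));
    last by lin.
  over.
by rewrite (counitr_sweedler (F := fun h => coinv_proj x t0 ⊗ h)) //; lin.
Qed.

End Structure.

Theorem theorem6p6 (k : fieldType) (H : hopfHeapType k) (B : {linear H -> H})
    (M : heapModType H) (T : {linear M -> M}) (x : H)
    (H_comm : commutative_heap H) (B_RB : rota_baxter_operator B)
    (T_RB : rota_baxter_module B T) (x_grouplike : grouplike x) :
  (forall z : M ⊗ H, exists w : coinv M x ⊗ H, hatT x B T z = coinv_incl w) /\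
  ((forall h : H, counit (B h) = counit h) ->
   exists2 T' : {linear (coinv M x ⊗ H)%type -> (coinv M x ⊗ H)%type},
     (forall w : coinv M x ⊗ H, coinv_incl (T' w) = hatT x B T (coinv_incl w)) &
     rota_baxter_module B T' /\ rota_baxter_module_isomorphic T T').
Proof.
split=> [z|counitB]; first exact: hatT_coinv.
pose f : {linear M -> (coinv M x ⊗ H)%type} := coinv_split x_grouplike.
pose g : {linear (coinv M x ⊗ H)%type -> M} := @coinv_act k H M x.
have fK : cancel f g by exact: coinv_splitK.
have gK : cancel g f by exact: coinv_actK.
(* Conjugating [T] makes compatibility with [f] and [g] formal; that [T'] restricts [hatT] is
   [hatT_intertwine] at [g w]. *)
pose T' : {linear (coinv M x ⊗ H)%type -> (coinv M x ⊗ H)%type} :=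
  (f \o (T \o g))%FUN.
have fM : rota_baxter_module_morphism T T' f.
  by split=> [|m]; [exact: coinv_split_morphism | rewrite /= fK].
exists T' => [w|].
  by rewrite -{2}(gK w) (hatT_intertwine x_grouplike T_RB counitB).
split; first exact: rota_baxter_module_transport fM gK T_RB.
exists f, g; split=> //; split=> [|w]; last by rewrite /= fK.
exact: coinv_act_morphism.
Qed.
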